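(* Let $k$ and $i$ be positive integers with $i > k/2$. Then $$T_{k,i} = \binom{k-1}{i-1}\binom{k}{\lceil k/2\rceil}.$$
   Context: A column is an infinite vertical stack of cells (with a bottom cell, and unbounded upward), and a board is a finite sequence of columns (so the columns are distinguishable). A position on a board is a placement of finitely many tokens in cells such that each token is either red or yellow, no two tokens occupy the same cell, and the occupied cells in each column form a contiguous block starting from the bottom. Equivalently, a position on an $n$-column board is an $n$-tuple of finite words over $\{R,Y\}$, each column being read from bottom to top. The size of a position is its number of tokens. A reachable position is one that can be obtained from the empty board by a finite sequence of moves, where each move inserts a token into the lowest empty cell of some column, and the inserted tokens alternate globally between red and yellow from move to move, the first move placing a red token. There is no win condition. On a board with at least $i$ columns, fix any $i$ of the columns; $T_{k,i}$ denotes the number of reachable positions of size $k$ in which precisely these $i$ columns are nonempty (this number depends only on $k$ and $i$, not on the board or on the choice of the columns). Binomial coefficients $\binom{a}{b}$ with $b > a \geq 0$ are $0$. *)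

(* Defs.v *)
From mathcomp Require Import all_boot finmap.
From mathcomp Require Import boolp classical_sets functions cardinality.

Set Implicit Arguments.
Unset Strict Implicit.
Unset Printing Implicit Defensive.

Notation color := bool.
Definition red : color := true.
Definition yellow : color := false.

(* Each column is the word of its tokens read from bottom to top, so that the
   tokens of a column automatically fill a contiguous block from the bottom. *)
Definition position (n : nat) := {ffun 'I_n -> seq color}.

Definition empty_board (n : nat) : position n := [ffun => [::]].

Definition insert_token (n : nat) (p : position n) (c : 'I_n) (x : color) :
  position n := [ffun j => if j == c then rcons (p j) x else p j].

(* Color of the move that follows t earlier moves; the first move is red. *)
Definition turn (t : nat) : color := if odd t then yellow else red.

Inductive reachable_in (n : nat) : nat -> position n -> Prop :=
| reachable_in0 : reachable_in 0 (empty_board n)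
| reachable_inS t p c :
    reachable_in t p -> reachable_in t.+1 (insert_token p c (turn t)).

Definition reachable (n : nat) (p : position n) : Prop :=
  exists t, reachable_in t p.

Definition position_size (n : nat) (p : position n) : nat :=
  \sum_(j < n) size (p j).

Definition nonempty_columns (n : nat) (p : position n) : {set 'I_n} :=
  [set j | p j != [::]].

Definition reachable_positions (n : nat) (S : {set 'I_n}) (k : nat) :
  set (position n) :=
  [set p | [/\ reachable p, position_size p = k & nonempty_columns p = S]]%classic.

(* fset_set sends infinite sets to the empty finite set; by
   finite_reachable_positions below this never happens here. *)
Definition T (n : nat) (S : {set 'I_n}) (k : nat) : nat :=
  #|` fset_set (reachable_positions S k)|%fset.

Lemma size_insert_token (n : nat) (p : position n) (c : 'I_n) (x : color) :
  position_size (insert_token p c x) = (position_size p).+1.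
Proof.
rewrite /position_size (bigD1 c) //= [in RHS](bigD1 c) //= ffunE eqxx size_rcons.
by rewrite addSn; congr (_ + _).+1; apply: eq_bigr => j /negbTE jc; rewrite ffunE jc.
Qed.

Lemma size_reachable_in (n t : nat) (p : position n) :
  reachable_in t p -> position_size p = t.
Proof.
elim=> [|{}t {}p c _ IH]; last by rewrite size_insert_token IH.
by rewrite /position_size big1 // => j _; rewrite ffunE.
Qed.

Lemma finite_reachable_positions (n : nat) (S : {set 'I_n}) (k : nat) :
  finite_set (reachable_positions S k).
Proof.
suff fin t : finite_set [set p : position n | reachable_in t p]%classic.
  apply: sub_finite_set (fin k) => p [[t tp] <- _] /=.
  by rewrite (size_reachable_in tp).
elim: t => [|t IH].
  apply: (@sub_finite_set _ _ [set empty_board n]%classic) => // p /= tp.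
  by inversion tp.
pose f (u : position n * 'I_n) := insert_token u.1 u.2 (turn t).
apply: (@sub_finite_set _ _
  (f @` ([set p | reachable_in t p] `*` [set: 'I_n]))%classic).
  by move=> p /= tp; inversion tp as [|t' q c tq]; exists (q, c).
by apply: finite_image; apply: finite_setX.
Qed.

(* Main.v *)
(* Reachable positions of size [k] have exactly [uphalf k] red tokens. Conversely,
   when the number of columns exceeds [k / 2], every such position is reachable:
   the last token to be played is found on top of some column, because otherwise
   every column would be topped by the other color, which has too few tokens; it
   is removed, and the argument repeated. It remains to count the positions with
   a given number of red tokens: reading the columns one after the other, these
   are pairs of a composition of [k] and a two-colored word of length [k]. *)
Require Import Defs.
From mathcomp Require Import all_boot finmap zify.
From mathcomp Require Import boolp classical_sets cardinality.

Set Implicit Arguments.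
Unset Strict Implicit.
Unset Printing Implicit Defensive.

(** * Reachability in terms of the number of red tokens *)

Definition color_count (n : nat) (x : color) (p : position n) : nat :=
  \sum_(j < n) count_mem x (p j).

Section Reachability.
Variable n : nat.
Implicit Types (p q : position n) (c j : 'I_n) (x y : color).

Lemma color_count_insert x p c y :
  color_count x (insert_token p c y) = color_count x p + (y == x).
Proof.
rewrite /color_count (bigD1 c) //= [in RHS](bigD1 c) //= ffunE eqxx.
rewrite -cats1 count_cat /= addn0 addnAC; congr (_ + _ + _).
by apply: eq_bigr => j /negbTE jc; rewrite ffunE jc.
Qed.

Lemma color_countC x p :
  color_count x p + color_count (~~ x) p = position_size p.
Proof.
rewrite /color_count -big_split; apply: eq_bigr => j _ /=.
by rewrite -(count_predC (pred1 x)); congr (_ + _); apply: eq_count => -[]; case: x.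
Qed.

Lemma color_count_reachable t p :
  reachable_in t p -> color_count red p = uphalf t.
Proof.
elim=> [|{}t {}p c _ IH]; last first.
  by rewrite color_count_insert IH /turn /red /yellow; case: ifP => /= ?; lia.
by rewrite /color_count big1 // => j _; rewrite ffunE.
Qed.

Lemma position_size0 p : position_size p = 0 -> p = empty_board n.
Proof.
move=> /eqP; rewrite sum_nat_eq0 => /forallP p0; apply/ffunP => j.
by rewrite ffunE; apply/nilP; apply: (implyP (p0 j)).
Qed.

Lemma nonempty_columns_insert p c x :
  nonempty_columns (insert_token p c x) = c |: nonempty_columns p.
Proof.
apply/setP=> j; rewrite !inE ffunE; case: (eqVneq j c) => //= _.
by case: (p j).
Qed.

(** This undoes a move: any top token may be regarded as the last one inserted. *)
Lemma insert_token_surj p c s x :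
  p c = rcons s x -> exists2 q, p = insert_token q c x & q c = s.
Proof.
move=> pc; exists [ffun j => if j == c then s else p j]; last by rewrite ffunE eqxx.
by apply/ffunP => j; rewrite !ffunE; case: eqP => [->|].
Qed.

(** If no column is topped by [x], the top tokens of the nonempty columns all have color [~~ x], so
    there are at least as many tokens of that color as nonempty columns. *)
Lemma top_token_exists x p :
  color_count (~~ x) p < #|nonempty_columns p| -> exists c s, p c = rcons s x.
Proof.
move=> lt_count; apply: contrapT => no_top; move: lt_count.
apply/negP; rewrite -leqNgt -sum1_card [leqRHS](bigID (mem (nonempty_columns p))) /=.
apply: leq_trans (leq_addr _ _); apply: leq_sum => j; rewrite inE.
case/lastP E: (p j) => [//|s y] _; rewrite -cats1 count_cat /= addn0.
have -> : y = ~~ x.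
  by case: (eqVneq y x) => [yx|]; [case: no_top; exists j, s; rewrite E yx|case: (y); case: (x)].
by rewrite eqxx addn1.
Qed.

Lemma tall_column_exists p :
  #|nonempty_columns p| < position_size p ->
  exists c s x, p c = rcons s x /\ s != [::].
Proof.
move=> lt_size; apply: contrapT => no_tall; move: lt_size.
apply/negP; rewrite -leqNgt -sum1_card big_mkcond /=; apply: leq_sum => j _; rewrite inE.
case/lastP E: (p j) => [|s y] //=; case: s E => [//|z s] E.
by case: no_tall; exists j, (z :: s), y.
Qed.

(** The induction is strong because one case peels two tokens. The difficulty is that peeling may
    empty a column and so break the bound on [t]. *)
Lemma reachable_in_of_color_count t p :
    position_size p = t -> color_count red p = uphalf t ->
    t < 2 * #|nonempty_columns p| ->
  reachable_in t p.
Proof.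
elim/ltn_ind: t p => -[|t] IH p sz_p red_p lt_p.
  by rewrite (position_size0 sz_p); constructor.
(* The bound on [q] is asked for only when [0 < t]: the empty board has no nonempty columns, so the
   strict inequality fails there. *)
have peel q c x : p = insert_token q c x -> x = turn t ->
    [/\ position_size q = t, color_count red q = uphalf t,
     #|nonempty_columns p| = (q c == [::]) + #|nonempty_columns q| &
     (0 < t -> t < 2 * #|nonempty_columns q|) -> reachable_in t.+1 p].
  move=> pE xE; have sz_q : position_size q = t.
    by move: sz_p; rewrite pE size_insert_token => -[].
  have red_q : color_count red q = uphalf t.
    move: red_p; rewrite pE color_count_insert xE /turn /red /yellow.
    by case: ifP => /= ?; lia.
  split=> //; first by rewrite pE nonempty_columns_insert cardsU1 inE negbK.
  move=> lt_q; rewrite pE xE; constructor.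
  have [t0|t_gt0] := posnP t; last by apply: IH => //; apply: lt_q.
  by rewrite t0 in sz_q *; rewrite (position_size0 sz_q); constructor.
have [c [s pc]] : exists c s, p c = rcons s (turn t).
  (* The color other than [turn t] has [uphalf t] tokens, fewer than the nonempty columns. *)
  apply: top_token_exists; move: lt_p (color_countC red p).
  rewrite /turn /red /yellow in red_p *; case: ifP => /= ?; lia.
have [q pE qc] := insert_token_surj pc.
have [sz_q red_q card_q reach_p] := peel q c _ pE erefl.
have [odd_t|even_t] := boolP (odd t).
  (* Here [t.+1] is even, so the strict bound on it has slack two, and it survives the loss of a
     column. *)
  by apply: reach_p => t_gt0; move: card_q; case: eqP => _; lia.
have turn_red : turn t = red by rewrite /turn (negbTE even_t).
(* A red token on top of a column of height at least two is preferred, since removing it empties no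
   column. *)
have [[c' [s' [pc' s'_neq0]]]|no_tall_red] :=
  pselect (exists c s, p c = rcons s red /\ s != [::]).
  have [q' pE' qc'] := insert_token_surj pc'.
  have [_ _ card_q' reach_p'] := peel q' c' _ pE' (esym turn_red).
  by apply: reach_p' => t_gt0; move: card_q'; rewrite qc' (negbTE s'_neq0); lia.
have s0 : s = [::].
  by apply/eqP/negPn/negP => s_neq0; apply: no_tall_red; exists c, s; rewrite -turn_red.
rewrite qc s0 eqxx in card_q.
have [t0|t_gt0] := posnP t; first by apply: reach_p; rewrite t0.
have [lt_q|le_q] := ltnP t (2 * #|nonempty_columns q|); first exact: reach_p.
(* Here [t] is exactly twice the number of columns of [q], so the hypothesis is
   lost by peeling one token; but [q] then has a column of height at least two,
   which is topped by yellow, and peeling that token as well restores it. *)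
have [|d [u [x [qd u_neq0]]]] := @tall_column_exists q; first by lia.
have xE : x = turn t.-1.
  have -> : turn t.-1 = yellow by rewrite /turn; case: ifP => //; lia.
  (* If [x] were red, column [d] would be tall and topped by red in [p] too: it differs from [c],
     which is empty in [q]. *)
  case: x qd => // qd; case: no_tall_red; exists d, u; split=> //.
  rewrite pE ffunE; case: eqP => // dc; move: qd.
  by rewrite dc qc s0; case: (u).
have [r qE rd] := insert_token_surj qd.
have card_r : #|nonempty_columns q| = #|nonempty_columns r|.
  by rewrite qE nonempty_columns_insert cardsU1 inE rd u_neq0.
rewrite pE; constructor; rewrite -(prednK t_gt0) qE xE; constructor.
apply: IH; [lia| | |by lia].
  by move: sz_q; rewrite qE size_insert_token => <-.
move: red_q; rewrite qE color_count_insert xE /turn /red /yellow.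
by case: ifP => /= ?; lia.
Qed.

Lemma reachable_size_iff k p : k < 2 * #|nonempty_columns p| ->
  (reachable p /\ position_size p = k) <->
  (position_size p = k /\ color_count red p = uphalf k).
Proof.
move=> lt_k; split=> [[[t tp] <-]|[sz_p red_p]].
  by rewrite (size_reachable_in tp) (color_count_reachable tp).
by split=> //; exists k; apply: reachable_in_of_color_count.
Qed.

End Reachability.


(** A word corresponds to the set of indices at which it is [true]. *)
Lemma card_tuple_count_mem (k r : nat) :
  #|[set w : k.-tuple bool | count_mem true w == r]| = 'C(k, r).
Proof.
pose f (A : {set 'I_k}) : k.-tuple bool := [tuple j \in A | j < k].
have f_bij : bijective f.
  exists (fun w => [set j | tnth w j]) => [A|w].
    by apply/setP => j; rewrite inE tnth_mktuple.
  by apply: eq_from_tnth => j; rewrite tnth_mktuple inE.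
rewrite -[k in RHS]card_ord -card_draws -(on_card_preimset (onW_bij _ f_bij)).
apply: eq_card => A; rewrite !inE; congr (_ == r).
rewrite count_map cardE /enum_mem size_filter -enumT.
by apply: eq_count => j /=; rewrite eqb_id.
Qed.

(** * Positions as pairs of column heights and a colored word *)

Section Counting.
Variables (n : nat) (S : {set 'I_n}).
Implicit Types (p : position n) (sh : seq nat) (w : seq color).

Definition columns p : seq (seq color) := [seq p j | j <- enum S].

(** Inverse of reading off the heights and the concatenated word of [columns p]. Outside [S] the
    index is out of range, so the default of [nth] makes the column empty. *)
Definition position_of sh w : position n :=
  [ffun j => nth [::] (reshape sh w) (index j (enum S))].

Lemma sum_columns (f : seq color -> nat) p :
    f [::] = 0 -> nonempty_columns p = S ->
  \sum_(j < n) f (p j) = sumn [seq f s | s <- columns p].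
Proof.
move=> f0 pS; rewrite sumnE !big_map big_enum /= [LHS](bigID (mem S)) /=.
rewrite [X in _ + X]big1 ?addn0 // => j.
by rewrite -pS inE negbK => /eqP ->.
Qed.

Lemma position_size_columns p : nonempty_columns p = S ->
  position_size p = size (flatten (columns p)).
Proof. by move=> pS; rewrite size_flatten; apply: sum_columns. Qed.

Lemma color_count_columns x p : nonempty_columns p = S ->
  color_count x p = count_mem x (flatten (columns p)).
Proof.
by move=> pS; rewrite count_flatten; apply: (sum_columns (f := count_mem x)).
Qed.

(** Each other column of [S] holds at least one token. *)
Lemma column_size_bound p j : nonempty_columns p = S -> j \in S ->
  size (p j) + #|S| <= (position_size p).+1.
Proof.
move=> pS jS; rewrite (cardsD1 j S) jS addnCA addSn ltnS add0n.
rewrite /position_size (bigD1 j) //= leq_add2l -sum1_card.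
rewrite [leqLHS]big_mkcond [leqRHS]big_mkcond /=.
apply: leq_sum => l _; rewrite 2!inE -pS inE.
by case: eqP => //= _; case: (p l).
Qed.

Lemma columnsK p : nonempty_columns p = S ->
  position_of (shape (columns p)) (flatten (columns p)) = p.
Proof.
move=> pS; apply/ffunP => j; rewrite ffunE flattenK.
have [jS|jS] := boolP (j \in S).
  by rewrite (nth_map j) ?nth_index ?index_mem ?mem_enum.
rewrite nth_default; last by rewrite size_map leqNgt index_mem mem_enum.
by move: jS; rewrite -pS inE negbK => /eqP.
Qed.

Lemma position_ofK sh w : size sh = #|S| ->
  columns (position_of sh w) = reshape sh w.
Proof.
move=> sz_sh; have sz : size (reshape sh w) = size (enum S).
  by rewrite size_reshape -cardE.
apply: (eq_from_nth (x0 := [::])); first by rewrite size_map.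
move=> m; rewrite size_map => m_lt.
have [j0 _] : exists j0, j0 \in enum S.
  by case: (enum S) m_lt => [//|j0 s] _; exists j0; rewrite mem_head.
by rewrite (nth_map j0) // ffunE index_uniq ?enum_uniq.
Qed.

Lemma nonempty_columns_position_of sh w :
    size sh = #|S| -> sumn sh = size w -> 0 \notin sh ->
  nonempty_columns (position_of sh w) = S.
Proof.
move=> sz_sh sz_w sh_gt0; apply/setP => j; rewrite inE ffunE.
have [jS|jS] := boolP (j \in S); last first.
  by rewrite nth_default // size_reshape sz_sh cardE leqNgt index_mem mem_enum.
rewrite -size_eq0 -(nth_map _ 0) ?size_reshape ?sz_sh ?cardE ?index_mem ?mem_enum //.
rewrite -/(shape _) reshapeKl ?sz_w //; apply: contraNneq sh_gt0 => <-.
by rewrite mem_nth // sz_sh cardE index_mem mem_enum.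
Qed.

Lemma card_balanced_positions (k r : nat) : 0 < k -> 0 < #|S| ->
  #|` fset_set [set p | [/\ position_size p = k, color_count red p = r
                         & nonempty_columns p = S]]%classic|
  = 'C(k - 1, #|S| - 1) * 'C(k, r).
Proof.
set A := (X in fset_set X) => k_gt0 S_gt0.
have [lt_kS|le_Sk] := ltnP k #|S|.
  rewrite [in RHS]bin_small; last by lia.
  have -> : A = set0; last by rewrite fset_set0 cardfs0.
  rewrite -subset0 => p [sz_p _ pS] /=; move: lt_kS; apply/negP; rewrite -leqNgt -sz_p.
  rewrite -{1}pS -sum1_card big_mkcond /=; apply: leq_sum => j _.
  by rewrite inE; case: (p j).
(* [d] counts the tokens beyond the first one of each column. Adding one to every part turns weak
   compositions of [d] into compositions of [k] with [#|S|] positive parts. *)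
set d := k - #|S|; set i := #|S|.-1.
have iE : #|S| = i.+1 by rewrite /i prednK.
have ikE : i + d = k - 1 by rewrite /i /d; lia.
pose sh (t : i.+1.-tuple 'I_d.+1) := [seq (val x).+1 | x <- t].
have size_sh t : size (sh t) = #|S| by rewrite size_map size_tuple.
have sumn_sh (t : i.+1.-tuple 'I_d.+1) : sumn (sh t) = \sum_(x <- t) x + #|S|.
  rewrite sumnE big_map iE -[X in _ + X](size_tuple t) -sum1_size -big_split /=.
  by apply: eq_bigr => x _; rewrite addn1.
pose X := finset.setX [set t : i.+1.-tuple 'I_d.+1 | \sum_(x <- t) x == d]
               [set w : k.-tuple bool | count_mem true w == r].
pose g (u : i.+1.-tuple 'I_d.+1 * k.-tuple bool) := position_of (sh u.1) u.2.
have XP u : u \in X -> [/\ sumn (sh u.1) = size u.2, count_mem true u.2 = r &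
    nonempty_columns (g u) = S].
  case: u => t w; rewrite !inE /= => /andP[/eqP sum_t /eqP count_w].
  have sz : sumn (sh t) = size w by rewrite sumn_sh sum_t size_tuple /d subnK.
  split=> //; apply: nonempty_columns_position_of => //.
  by apply/mapP => -[].
have AE : A = [set` [fset g u | u in X]%fset]%classic.
  apply/seteqP; split=> p.
    move=> [sz_p count_p pS]; apply/imfsetP => /=.
    have col_gt0 c : c \in columns p -> 0 < size c.
      by case/mapP => j; rewrite mem_enum -{1}pS inE lt0n size_eq0 => ? ->.
    have w_sz : size (flatten (columns p)) == k by rewrite -position_size_columns ?sz_p.
    have t_sz : size [seq inord (size c).-1 : 'I_d.+1 | c <- columns p] == i.+1.
      by rewrite !size_map -cardE iE.
    have shE : sh (Tuple t_sz) = shape (columns p).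
      rewrite /sh /= -map_comp; apply/eq_in_map => c c_in /=.
      (* [inord] truncates nothing: by [column_size_bound] a height is at most [d.+1]. *)
      rewrite inordK; first by rewrite prednK ?col_gt0.
      case/mapP: (c_in) => j; rewrite mem_enum => jS cE.
      by have := column_size_bound pS jS; rewrite -cE sz_p /d; lia.
    exists (Tuple t_sz, Tuple w_sz); last by rewrite /g shE columnsK.
    rewrite !inE /= -color_count_columns // count_p eqxx andbT.
    rewrite -(eqn_add2r #|S|) -(sumn_sh (Tuple t_sz)) shE -size_flatten (eqP w_sz).
    by rewrite /d subnK.
  case/imfsetP => -[t w] /XP /= [sz_w count_w gS] ->.
  have fl : flatten (columns (g (t, w))) = w.
    by rewrite position_ofK ?reshapeKr ?sz_w.
  by split=> //; rewrite ?position_size_columns ?color_count_columns ?fl ?size_tuple.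
(* [g] is injective on [X], because [reshape] determines both the heights and the word when their
   sizes agree. *)
rewrite AE set_fsetK card_in_imfset /=; last first.
  move=> [t w] [t' w'] /XP /= [sz_w _ _] /XP /= [sz_w' _ _] /(congr1 columns).
  rewrite !position_ofK // => rE; congr (_, _); apply: val_inj => /=.
    apply: (inj_map val_inj); apply: (inj_map succn_inj).
    rewrite -!map_comp -[LHS]/(sh t) -[RHS]/(sh t').
    by rewrite -(@reshapeKl _ (sh t) w) ?sz_w // rE reshapeKl ?sz_w'.
  by rewrite -(@reshapeKr _ (sh t) w) ?sz_w // rE reshapeKr ?sz_w'.
rewrite -cardE cardsX card_ord_partitions card_tuple_count_mem.
by rewrite ikE [#|S| - 1]subn1.
Qed.

End Counting.

Theorem corollary4 (n k i : nat) (S : {set 'I_n})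
    (k_gt0 : 0 < k) (i_gt0 : 0 < i) (ltk2i : k < 2 * i) (cardS : #|S| = i) :
  T S k = 'C(k - 1, i - 1) * 'C(k, uphalf k).
Proof.
rewrite -cardS -card_balanced_positions ?cardS // /T.
congr (#|` fset_set _|)%fset; apply/seteqP; split=> p /=.
  move=> [p_reach sz_p pS]; have lt_p : k < 2 * #|nonempty_columns p| by rewrite pS cardS.
  by have [] := (reachable_size_iff lt_p).1 (conj p_reach sz_p).
move=> [sz_p red_p pS]; have lt_p : k < 2 * #|nonempty_columns p| by rewrite pS cardS.
by have [] := (reachable_size_iff lt_p).2 (conj sz_p red_p).
Qed.
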